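(* For every infinite cardinal $\lambda$, and every GO space $X$, the following conditions are equivalent. (1) $X$ is $D$-compact, for some regular ultrafilter $D$ over $\lambda$. (2) $X$ is initially $\lambda$-compact. (3) For every infinite regular cardinal $\nu\leq\lambda$, and every strictly increasing (resp., strictly decreasing) $\nu$-indexed sequence of elements of $X$, the sequence has a supremum (resp., an infimum) to which it converges. (4) $X$ has neither a gap nor a pseudo-gap having type $\leq\lambda$. (5) $X$ is $D$-pseudocompact, for some regular ultrafilter $D$ over $\lambda$. (6) $X$ is weakly initially $\lambda$-compact. (7) For every infinite (equivalently, every infinite regular) cardinal $\nu\leq\lambda$, and every sequence $(O_\gamma)_{\gamma<\nu}$ of open nonempty sets of $X$, there is $x\in X$ such that $|\{\gamma<\nu\mid O_\gamma\cap U\neq\emptyset\}|=\nu$ for every neighborhood $U$ of $x$. (In this condition one can equivalently require either that the $O_\gamma$'s are pairwise disjoint, or that $O_\gamma\subset O_{\gamma'}$ for $\gamma>\gamma'$.) (8) $X$ is $D$-compact, for every ultrafilter $D$ over any set of cardinality $\leq\lambda$. (9) $X$ is $D$-pseudocompact, for every ultrafilter $D$ over any set of cardinality $\leq\lambda$. (10) $X$ is $\lambda$-bounded, that is, every subset of $X$ of cardinality $\leq\lambda$ has compact closure.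
   Context: A GO space (generalized ordered topological space) is a linearly ordered set with a Hausdorff topology having a base of order-convex sets. Ultrafilters are proper. The symbol $\subset$ denotes proper inclusion. An ultrafilter $D$ over $\lambda$ is regular if there is a family $(Z_\alpha)_{\alpha\in\lambda}$ of members of $D$ such that the intersection of any infinite subfamily is empty. If $D$ is an ultrafilter over $I$, a topological space $X$ is $D$-compact if every $I$-indexed sequence $(x_i)_{i\in I}$ of elements of $X$ $D$-converges to some $x\in X$, that is, $\{i\in I\mid x_i\in U\}\in D$ for every open neighborhood $U$ of $x$. $X$ is $D$-pseudocompact if for every sequence $(O_i)_{i\in I}$ of nonempty open sets of $X$ there is $x\in X$ such that $\{i\in I\mid U\cap O_i\neq\emptyset\}\in D$ for every neighborhood $U$ of $x$. A topological space is initially $\lambda$-compact if every open cover of cardinality $\leq\lambda$ has a finite subcover. It is weakly initially $\lambda$-compact if every open cover of cardinality $\leq\lambda$ has a finite subfamily with dense union. A sequence $(x_\gamma)_{\gamma<\nu}$ converges to $x$ if for every neighborhood $U$ of $x$ there is $\gamma<\nu$ such that $x_{\gamma'}\in U$ for every $\gamma'>\gamma$ ($\gamma'<\nu$). Let $X$ be a GO space and consider ordered pairs $(A,B)$ of open subsets of $X$ such that $A\cup B=X$ and $a<b$ for every $a\in A$, $b\in B$. Such a pair is a gap of $X$ if $A$ has no maximum and $B$ has no minimum ($A$ or $B$ is allowed to be empty). Such a pair is a pseudo-gap of $X$ if $A$ and $B$ are both nonempty and either $A$ has a maximum and $B$ has no minimum, or $A$ has no maximum and $B$ has a minimum. An infinite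 cardinal $\mu$ is a type of a gap $(A,B)$ if either $A$ has cofinality $\mu$ or $B$ has coinitiality $\mu$ (so an empty side contributes no type). The type of a pseudo-gap $(A,B)$ is the cofinality of $A$ if $B$ has a minimum, and the coinitiality of $B$ if $A$ has a maximum. *)

(* Defs.v *)
From mathcomp Require Import all_boot all_order.
From mathcomp Require Import all_classical wochoice topology.

Set Implicit Arguments.
Unset Strict Implicit.
Unset Printing Implicit Defensive.

Import Order.TTheory.
Local Open Scope classical_set_scope.
Local Open Scope card_scope.
Local Open Scope order_scope.

(* Cardinals are initial ordinals: a cardinal nu is a well-ordered type N none
   of whose proper initial segments has the size of N. An indexing by all
   gamma < nu is a function on N. Elsewhere only the size [set: N] matters. *)

Definition is_cardinal d (N : orderType d) : Prop :=
  well_order (<=%O : rel N) /\ forall a : N, ~ ([set: N] #<= [set x : N | x < a]).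

Definition infinite_cardinal d (N : orderType d) : Prop :=
  is_cardinal N /\ infinite_set [set: N].

Section cofinality.
Context d (T : porderType d).
Implicit Types A C : set T.

Definition cofinal A C := C `<=` A /\ forall a, A a -> exists2 c, C c & a <= c.

Definition coinitial A C := C `<=` A /\ forall a, A a -> exists2 c, C c & c <= a.

(* the least cardinality of a cofinal (resp. coinitial) subset of A is |M| *)
Definition cofinality A (M : Type) : Prop :=
  (exists2 C, cofinal A C & C #= [set: M]) /\
  forall C, cofinal A C -> [set: M] #<= C.

Definition coinitiality A (M : Type) : Prop :=
  (exists2 C, coinitial A C & C #= [set: M]) /\
  forall C, coinitial A C -> [set: M] #<= C.

Definition has_max A := exists2 m, A m & ubound A m.

Definition has_min A := exists2 m, A m & lbound A m.

Definition order_convex A :=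
  forall x y z, A x -> A z -> x <= y -> y <= z -> A y.

End cofinality.

Definition infinite_regular d (N : orderType d) : Prop :=
  infinite_cardinal N /\ cofinality [set: N] N.

(* The library has no type that joins a topology with a total order without
   tying the two together, so totality is part of the predicate. *)
Definition GO_space d (X : POrderedTopological.type d) : Prop :=
  [/\ total (<=%O : rel X), hausdorff_space X
    & exists2 B : set (set X), basis B & B `<=` @order_convex d X].

Definition regular_ultrafilter (L : Type) (D : set_system L) : Prop :=
  UltraFilter D /\
  exists2 Z : L -> set L, (forall a, D (Z a)) &
    forall A : set L, infinite_set A -> \bigcap_(a in A) Z a = set0.

Section compactness.
Context (X : topologicalType).

Definition D_compact (I : Type) (D : set_system I) : Prop :=
  forall x : I -> X, exists l : X, x @ D --> l.

Definition D_pseudocompact (I : Type) (D : set_system I) : Prop :=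
  forall O : I -> set X, (forall i, open (O i) /\ O i !=set0) ->
  exists x : X, forall U, nbhs x U -> D [set i | U `&` O i !=set0].

Definition initially_compact (L : Type) : Prop :=
  forall F : set (set X), F #<= [set: L] -> F `<=` open ->
  \bigcup_(U in F) U = [set: X] ->
  exists G : set (set X),
    [/\ G `<=` F, finite_set G & \bigcup_(U in G) U = [set: X]].

Definition weakly_initially_compact (L : Type) : Prop :=
  forall F : set (set X), F #<= [set: L] -> F `<=` open ->
  \bigcup_(U in F) U = [set: X] ->
  exists G : set (set X),
    [/\ G `<=` F, finite_set G & dense (\bigcup_(U in G) U)].

Definition lambda_bounded (L : Type) : Prop :=
  forall S : set X, S #<= [set: L] -> compact (closure S).

Definition seq_cvg d (N : orderType d) (x : N -> X) (l : X) : Prop :=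
  forall U, nbhs l U -> exists g : N, forall g', g < g' -> U (x g').

(* The condition is parametrized by the class of cardinals nu considered and by
   the extra requirement P on the sequences of open sets. *)
Definition open_accumulation (L : Type)
    (is_nu : forall d, orderType d -> Prop)
    (P : forall d (N : orderType d), (N -> set X) -> Prop) : Prop :=
  forall d (N : orderType d), is_nu d N -> [set: N] #<= [set: L] ->
  forall O : N -> set X, (forall g, open (O g) /\ O g !=set0) -> P d N O ->
  exists x : X, forall U, nbhs x U ->
    [set g | O g `&` U !=set0] #= [set: N].

Definition any_sets d (N : orderType d) (O : N -> set X) := True.

Definition disjoint_sets d (N : orderType d) (O : N -> set X) :=
  trivIset [set: N] O.

Definition decreasing_sets d (N : orderType d) (O : N -> set X) :=
  forall g g' : N, g' < g -> O g `<` O g'.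

End compactness.

Section go_spaces.
Context d (X : POrderedTopological.type d).
Implicit Types A B : set X.

Definition monotone_sequences_converge (L : Type) : Prop :=
  forall d' (N : orderType d'), infinite_regular N -> [set: N] #<= [set: L] ->
  forall x : N -> X,
    ((forall a b, a < b -> x a < x b) ->
       exists2 s, supremums (range x) s & seq_cvg x s) /\
    ((forall a b, a < b -> x b < x a) ->
       exists2 s, infimums (range x) s & seq_cvg x s).

Definition open_cut A B : Prop :=
  [/\ open A, open B, A `|` B = [set: X]
    & forall a b, A a -> B b -> a < b].

Definition gap A B : Prop := [/\ open_cut A B, ~ has_max A & ~ has_min B].

Definition pseudo_gap A B : Prop :=
  [/\ open_cut A B, A !=set0, B !=set0
    & (has_max A /\ ~ has_min B) \/ (~ has_max A /\ has_min B)].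

Definition type_of_gap A B d' (M : orderType d') : Prop :=
  infinite_cardinal M /\ (cofinality A M \/ coinitiality B M).

Definition type_of_pseudo_gap A B d' (M : orderType d') : Prop :=
  is_cardinal M /\
  ((has_min B /\ cofinality A M) \/ (has_max A /\ coinitiality B M)).

Definition no_gap_of_type_le (L : Type) : Prop :=
  forall A B d' (M : orderType d'), [set: M] #<= [set: L] ->
    ~ (gap A B /\ type_of_gap A B M) /\
    ~ (pseudo_gap A B /\ type_of_pseudo_gap A B M).

End go_spaces.

(* Main.v *)
Require Import Defs.
From mathcomp Require Import all_boot all_order.
From mathcomp Require Import all_classical topology.
From HB Require Import structures.
From mathcomp Require Import wochoice.

Set Implicit Arguments.
Unset Strict Implicit.
Unset Printing Implicit Defensive.

Import Order.TTheory.

Local Open Scope order_scope.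
Local Open Scope classical_set_scope.
Local Open Scope card_scope.

(** The hub of the equivalence is the pair of conditions (no gap or pseudo-gap of
   type at most [|L|]) and ([L]-boundedness); everything else lies between them.

   Boundedness follows from the absence of gaps in [no_gap_bounded]. Let [F] be
   an ultrafilter without limit. Every point [p] has [F] on exactly one side, and
   since [p] has a convex neighbourhood outside [F], the points with [F] above
   them form an open set [A] and those with [F] below them an open set [B]; so
   [(A, B)] is a gap or a pseudo-gap. If [F] contains [A] and the closure of a
   set [S] of size at most [|L|], then [S] is cofinal in [A], and the cofinality
   of [A] is a type at most [|L|], which is excluded. The other side is the same
   argument for the reversed order, and this is how all left-right symmetries
   are treated: a [GO_space] is again one when its order is reversed.

   Boundedness gives compactness along every ultrafilter on a small set at once,
   and the convergence of monotone sequences because a cluster point of a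
   monotone sequence is its limit. Compactness along one regular ultrafilter
   gives the covering conditions: each index lies in finitely many of the sets
   [Z a], so the ultrafilter sees a family of size [|L|] through finite parts
   ([regular_finite_parts]). Pseudocompactness along all ultrafilters gives
   accumulation points for every infinite cardinal [N], because a regular
   ultrafilter on [N] contains only sets of full size
   ([regular_ultrafilter_uniform]); for regular [N] weak initial compactness is
   enough ([weakly_initially_compact_accumulation]).

   Conversely, let [(A, B)] be an open cut such that [A] has no maximum and its
   cofinality [M] is small. Then [M] is regular and [A] has a strictly increasing
   cofinal sequence of length [M] ([cofinal_sequence]). It cannot converge, and
   the traces on [A] of its final rays, or disjoint intervals between its terms,
   do not accumulate anywhere. Hence each of the weak conditions excludes gaps.

   Regular ultrafilters exist on an infinite [T] because the finite sequences in
   [T] can be indexed by [T], which rests on [|T| * |T| = |T|] ([card_square]).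
   That in turn is proved by well-founded induction with Goedel's order on
   pairs. *)

(** * Comparing cardinals along a well-founded order *)

Lemma card_le_fun (T U : Type) (A : set T) (B : set U) (f : T -> U) :
  (forall x, A x -> B (f x)) ->
  (forall x y, A x -> A y -> f x = f y -> x = y) -> A #<= B.
Proof.
move=> fAB fI; suff [g] : $|{injfun A >-> B}| by exact: inj_card_le.
apply/injfunPex; exists f => // x y; rewrite !inE => Ax Ay; exact: fI.
Qed.

Lemma card_le_funP (T U : Type) (A : set T) (B : set U) (u0 : U) :
  A #<= B -> exists f : T -> U, (forall x, A x -> B (f x)) /\
    (forall x y, A x -> A y -> f x = f y -> x = y).
Proof.
pose U' : pointedType := HB.pack {classic U} (isPointed.Build {classic U} u0).
move=> /(@pcard_leP T U')[f]; exists f; split; first by move=> x Ax; exact: funS.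
by move=> x y Ax Ay; apply: inj; rewrite inE.
Qed.

Lemma card_le_onto (T U : Type) (A : set T) (B : set U) (t0 : T) :
  A #<= B -> exists f : U -> T, forall x, A x -> exists2 u, B u & f u = x.
Proof.
move=> /pfcard_geP[->|[f]]; first by exists (fun=> t0).
by exists f => x Ax; have [u Bu] := @surj _ _ _ _ f x Ax; exists u.
Qed.

Lemma card_le_nonempty (T U : Type) (A : set T) (B : set U) :
  A #<= B -> A !=set0 -> B !=set0.
Proof.
by move=> AB A0; apply/set0P; apply: contraPN A0 => /eqP B0; move: AB;
  rewrite B0 card_le0 => /eqP -> [].
Qed.

Lemma card_leX (T T' U U' : Type) (A : set T) (A' : set T') (B : set U)
    (B' : set U') : A #<= B -> A' #<= B' -> A `*` A' #<= B `*` B'.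
Proof.
have [->|/set0P A0] := eqVneq A set0; first by rewrite set0X.
have [->|/set0P A'0] := eqVneq A' set0; first by rewrite setX0.
move=> AB A'B'.
have [b _] := card_le_nonempty AB A0.
have [b' _] := card_le_nonempty A'B' A'0.
have [f [fAB fI]] := card_le_funP b AB.
have [f' [fAB' fI']] := card_le_funP b' A'B'.
apply: (@card_le_fun _ _ _ _ (fun x => (f x.1, f' x.2))).
  by move=> [x x'] /= [Ax Ax']; split=> /=; [exact: fAB|exact: fAB'].
move=> [x x'] [y y'] /= [Ax Ax'] [Ay Ay'] [e e'].
by rewrite (fI x y)// (fI' x' y').
Qed.

Lemma card_le_setU1 (T : Type) (A : set T) (x : T) :
  infinite_set A -> A `|` [set x] #<= A.
Proof.
move=> Ainf; have [Ax|nAx] := pselect (A x).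
  rewrite (_ : A `|` _ = A) ?card_lexx//.
  by apply/seteqP; split=> y; [case=> [//|->]|left].
have [a0 Aa0] := infinite_setN0 Ainf.
have /infiniteP/(card_le_funP a0)[g [gA gI]] := Ainf.
(* Hilbert's hotel: the sequence g makes room for x *)
pose f y := if pselect (exists n, g n = y) is left h then g (projT1 (cid h)).+1
            else if pselect (A y) then y else g 0.
have fg n : f (g n) = g n.+1.
  rewrite /f; case: pselect => [h|[]]; last by exists n.
  by congr (g _.+1); case: cid => m /= /gI ->.
have fx : f x = g 0.
  rewrite /f; case: pselect => [h|_]; last by case: pselect.
  by exfalso; case: h => n gn; apply: nAx; rewrite -gn; exact: gA.
have fo y : A y -> ~ (exists n, g n = y) -> f y = y.
  by move=> Ay ny; rewrite /f; case: pselect => // _; case: pselect.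
have cases y : (A `|` [set x]) y ->
    [\/ y = x, exists n, y = g n | [/\ A y, ~ (exists n, g n = y) & f y = y]].
  case=> [Ay|->]; last by constructor 1.
  have [[n <-]|ny] := pselect (exists n, g n = y).
    by constructor 2; exists n.
  by constructor 3; split=> //; exact: fo.
apply: (@card_le_fun _ _ _ _ f).
  by move=> y /cases[->|[n ->]|[Ay _ ->//]]; rewrite ?fx ?fg; exact: gA.
move=> y z /cases[->|[n ->]|[Ay ny fy]] /cases[->|[m ->]|[Az nz fz]] //;
  rewrite ?fx ?fg ?fy ?fz.
- by move/gI => /(_ I I).
- by move=> gz; case: nz; exists 0.
- by move/gI => /(_ I I).
- by move/gI => /(_ I I) [->].
- by move=> gz; case: nz; exists n.+1.
- by move=> gy; case: ny; exists 0.
- by move=> gy; case: ny; exists m.+1.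
- by [].
Qed.

Section well_founded.
Context (W : Type) (lt : W -> W -> Prop).
Hypothesis lt_wf : well_founded lt.

Lemma wf_minimal (P : set W) : P !=set0 ->
  exists2 w, P w & forall v, lt v w -> ~ P v.
Proof.
move=> [w Pw]; apply: contrapT => noP.
elim/(well_founded_ind lt_wf): w Pw => w IH Pw.
by apply: noP; exists w => // v /IH.
Qed.

Lemma wf_rec (T : Type) (F : W -> set T -> T) :
  exists f : W -> T, forall w, f w = F w (f @` [set v | lt v w]).
Proof.
pose G w (rec : forall v, lt v w -> T) :=
  F w [set t | exists v, exists h : lt v w, rec v h = t].
exists (Fix lt_wf (fun=> T) G) => w; rewrite Fix_eq.
  rewrite /G; congr F; apply/seteqP; split=> t [v].
    by move=> [h <-]; exists v.
  by move=> h <-; exists v, h.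
move=> x f g fg; rewrite /G; congr F; apply/seteqP.
by split=> t [v [h <-]]; exists v, h; rewrite fg.
Qed.

Hypothesis lt_total : forall v w, [\/ lt v w, v = w | lt w v].

(** The absence of transitivity would produce a cycle of length two or three,
   which has no minimal element. *)
Lemma wf_trans u v w : lt u v -> lt v w -> lt u w.
Proof.
move=> uv vw; have [//|uw|wu] := lt_total u w; exfalso.
  have [|z + zmin] := @wf_minimal [set z | z = u \/ z = v]; first by exists u; left.
  case=> zE; rewrite {}zE in zmin.
  - by apply: (zmin v); [rewrite uw|right].
  - by apply: (zmin u) => //; left.
have [|z + zmin] := @wf_minimal [set z | [\/ z = u, z = v | z = w]].
  by exists u; constructor 1.
case=> zE; rewrite {}zE in zmin.
- by apply: (zmin w) => //; constructor 3.
- by apply: (zmin u) => //; constructor 1.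
- by apply: (zmin v) => //; constructor 2.
Qed.

(** Sending each point to a new element of [A] as long as there is one either
   embeds [D] or exhausts [A] at some point of [D]. *)
Lemma wf_compare (T : Type) (D : set W) (A : set T) :
  D #<= A \/ exists2 w, D w & A #= D `&` [set v | lt v w].
Proof.
pose F (w : W) (S : set (option T)) : option T :=
  @xget {classic option T} None [set o | [/\ D w, (Some @` A) o & ~ S o]].
(* f is injective where it is not None; on D it is None only once A is used up *)
have [f fE] := wf_rec F.
have fA w a : f w = Some a -> [/\ D w, A a & forall v, lt v w -> f v <> Some a].
  rewrite fE /F; case: xgetP => [o -> [Dw [b Ab <-] nS] [ba]|//].
  by rewrite ba in nS Ab; split=> // v vw fv; apply: nS; exists v.
have finj v w a : f v = Some a -> f w = Some a -> v = w.
  move=> fv fw; have [vw|//|wv] := lt_total v w.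
    by have [_ _ /(_ v vw)] := fA _ _ fw.
  by have [_ _ /(_ w wv)] := fA _ _ fv.
have [allD|] := pselect (forall w, D w -> f w <> None).
  have [->|/set0P[w0 Dw0]] := eqVneq D set0; first by left.
  have [a0 fw0] : exists a0, f w0 = Some a0.
    by case: (f w0) (allD _ Dw0) => // a _; exists a.
  have fS w : D w -> f w = Some (odflt a0 (f w)).
    by move=> /allD; case: (f w).
  left; apply: (@card_le_fun _ _ _ _ (fun w => odflt a0 (f w))).
    by move=> w /fS/fA[].
  by move=> v w /fS + /fS fw e; rewrite e => /finj; apply.
move=> /existsNP[w1 /not_implyP[Dw1 /contrapT fw1]]; right.
have [w [Dw fw] wmin] := @wf_minimal [set w | D w /\ f w = None]
  (ex_intro _ w1 (conj Dw1 fw1)).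
exists w => //.
have onto a : A a -> exists2 v, lt v w & f v = Some a.
  move=> Aa; apply: contrapT => nv; move: fw; rewrite fE /F.
  case: xgetP => [o -> [_ [b _ <-]]//|nS _].
  apply: (nS (Some a)); split=> //.
apply/card_eqPle; split.
  have [->|/set0P[a0 Aa0]] := eqVneq A set0; first exact: card_ge0.
  have [h hP] : {h : T -> W & forall a, A a -> lt (h a) w /\ f (h a) = Some a}.
    have /choice[h hP] : forall a, exists v, A a -> lt v w /\ f v = Some a.
      move=> a; have [Aa|nAa] := pselect (A a); last by exists w.
      by have [v] := onto a Aa; exists v.
    by exists h.
  apply: (@card_le_fun _ _ _ _ h).
    by move=> a /hP[hw /fA[]].
  by move=> a b /hP[_ fa] /hP[_ fb] e; move: fb; rewrite -e fa => -[].
have fS v : D v -> lt v w -> exists a, f v = Some a.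
  move=> Dv vw; case fv : (f v) => [a|]; first by exists a.
  by case: (wmin v vw); split.
have [->|/set0P[v0 [Dv0 v0w]]] := eqVneq (D `&` [set v | lt v w]) set0.
  exact: card_ge0.
have [a0 _] := fS v0 Dv0 v0w.
have fS' v : D v -> lt v w -> f v = Some (odflt a0 (f v)).
  by move=> Dv vw; have [a ->] := fS v Dv vw.
apply: (@card_le_fun _ _ _ _ (fun v => odflt a0 (f v))).
  by move=> v [Dv vw]; have /fA[] := fS' v Dv vw.
move=> u v [Du uw] [Dv vw] e; apply: finj (fS' v Dv vw).
by rewrite (fS' u Du uw) e.
Qed.

End well_founded.

(** * Squares and finite sequences of infinite sets *)

Lemma wf_of_minimal (W : Type) (lt : W -> W -> Prop) :
  (forall P : set W, P !=set0 -> exists2 w, P w & forall v, lt v w -> ~ P v) ->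
  well_founded lt.
Proof.
move=> hmin w; apply: contrapT => nw.
have [z nz zmin] := hmin [set w | ~ Acc lt w] (ex_intro _ w nw).
by apply: nz; constructor => v /zmin/contrapT.
Qed.

Section strict_well_order.
Context (T : eqType) (R : rel T).
Hypothesis Rwo : well_order R.

Lemma well_order_min (P : set T) : P !=set0 ->
  exists2 z, P z & forall y, P y -> R z y.
Proof.
move=> [x Px]; have [|z [[Pz zmin] _]] := Rwo (A := fun x => `[< P x >]).
  by exists x; apply/asboolP.
by exists z => [|y Py]; [exact/asboolP | apply: zmin; exact/asboolP].
Qed.

Lemma well_order_pair x y : R x y \/ R y x.
Proof.
have [|z zE zmin] := @well_order_min [set z | z = x \/ z = y].
  by exists x; left.
by case: zE => <-; [left|right]; apply: zmin; [right|left].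
Qed.

Lemma well_order_anti x y : R x y -> R y x -> x = y.
Proof.
move=> xy yx; have [|z [_ zuniq]] := Rwo (A := fun z => `[< z = x \/ z = y >]).
  by exists x; apply/asboolP; left.
have refl u : R u u by case: (well_order_pair u u).
rewrite -(zuniq x) ?(zuniq y)//; split; try (by apply/asboolP; auto);
  by move=> u /asboolP[->|->].
Qed.

Definition strict_part (x y : T) := R x y /\ x <> y.

Lemma strict_wf : well_founded strict_part.
Proof.
apply: wf_of_minimal => P /well_order_min[z Pz zmin]; exists z => // v [vz nvz].
by move=> /zmin zv; apply: nvz; exact: well_order_anti.
Qed.

Lemma strict_total x y : [\/ strict_part x y, x = y | strict_part y x].
Proof.
have [->|/eqP xy] := eqVneq x y; first by constructor 2.
have [?|?] := well_order_pair x y; first by constructor 1.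
by constructor 3; split=> // /esym.
Qed.

End strict_well_order.

Section square.
Context (W : Type) (lt : W -> W -> Prop).
Hypothesis lt_wf : well_founded lt.
Hypothesis lt_total : forall v w, [\/ lt v w, v = w | lt w v].

Let top (p : W * W) := if `[< lt p.1 p.2 >] then p.2 else p.1.

Let le_top1 p : lt p.1 (top p) \/ p.1 = top p.
Proof. by rewrite /top; case: asboolP => h; [left|right]. Qed.

Let le_top2 p : lt p.2 (top p) \/ p.2 = top p.
Proof.
rewrite /top; case: asboolP => h; [by right|].
by case: (lt_total p.1 p.2) => [/h//|->|]; [right|left].
Qed.

(** Under Goedel's order on pairs, by the larger coordinate first, the pairs
   below a given one lie in the square of a proper initial segment. That square
   has the size of the segment by induction, so if [D] were exhausted below some
   pair then [D], and with it its square, would embed in a proper segment. *)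
Lemma card_square_step (D : set W) : infinite_set D ->
  (forall w, D w -> [set v | lt v w] `<=` D) ->
  (forall w, D w -> infinite_set [set v | lt v w] ->
     [set v | lt v w] `*` [set v | lt v w] #<= [set v | lt v w]) ->
  D `*` D #<= D.
Proof.
move=> Dinf Ddown IH.
have [S /[dup]/strict_wf Swf /strict_total Stot] :=
  well_ordering_principle {classic W * W}.
(* S is an arbitrary well-order: it only breaks ties between equal maxima *)
pose lt2 p q := lt (top p) (top q) \/ top p = top q /\ strict_part S p q.
have lt2_wf : well_founded lt2.
  apply: wf_of_minimal => P [p0 Pp0].
  have [|m [p1 Pp1 p1m] mmin] := @wf_minimal _ _ lt_wf (top @` P).
    by exists (top p0), p0.
  have [|p [Pp pm] pmin] := @wf_minimal _ _ Swf [set p | P p /\ top p = m].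
    by exists p1.
  exists p => // q [qp|[qp Sqp]] Pq.
    by apply: (mmin (top q)); [rewrite -pm|exists q].
  by apply: (pmin q Sqp); split=> //; rewrite qp.
have lt2_total p q : [\/ lt2 p q, p = q | lt2 q p].
  case: (lt_total (top p) (top q)) => [h|e|h].
  - by constructor 1; left.
  - case: (Stot p q) => [h|->|h]; first by constructor 1; right.
    + by constructor 2.
    + by constructor 3; right.
  - by constructor 3; left.
case: (wf_compare lt2_wf lt2_total (D `*` D) D) => // -[p [Dp1 Dp2] Dp].
set m := top p; set M := [set v | lt v m].
have Dm : D m by rewrite /m /top; case: ifP.
have le_m x : lt x m \/ x = m -> (M `|` [set m]) x by case=> ?; [left|right].
have DM : D #<= (M `|` [set m]) `*` (M `|` [set m]).
  move/card_eqPle: Dp => [/card_le_trans + _]; apply.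
  apply: subset_card_le => q [_ /= qp].
  have qm x : lt x (top q) \/ x = top q -> lt x m \/ x = m.
    case: qp => [qp|[-> _]//] [h|->]; left => //.
    exact: (wf_trans lt_wf lt_total h).
  by split; apply: le_m; apply: qm; [exact: le_top1|exact: le_top2].
have [Mfin|Minf] := pselect (finite_set M).
  exfalso; apply: Dinf; apply: card_le_finite DM _.
  by apply: finite_setX; rewrite finite_setU; split=> //; exact: finite_set1.
have {}DM : D #<= M.
  apply: card_le_trans DM _; apply: card_le_trans (IH m Dm Minf).
  by apply: card_leX; exact: card_le_setU1.
apply: card_le_trans (card_leX DM DM) _; apply: card_le_trans (IH m Dm Minf) _.
exact/subset_card_le/Ddown.
Qed.

Lemma card_square_wf : infinite_set [set: W] ->
  [set: W] `*` [set: W] #<= [set: W].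
Proof.
move=> Winf; apply: card_square_step => // w _.
elim/(well_founded_ind lt_wf): w => w IH winf; apply: card_square_step => // v vw u uv.
exact: (wf_trans lt_wf lt_total uv vw).
Qed.

End square.

Lemma card_square (T : Type) (A : set T) : infinite_set A -> A `*` A #<= A.
Proof.
move=> Ainf; have [R Rwo] := well_ordering_principle {classic set_type A}.
have := card_square_wf (strict_wf Rwo) (strict_total Rwo).
have /card_eqPle[AT TA] : [set: set_type A] #= A by exact: card_setT.
move=> sq; apply: card_le_trans (card_leX TA TA) (card_le_trans _ AT).
by apply: sq => Afin; apply: Ainf; exact: card_le_finite TA Afin.
Qed.

Lemma card_square_type (T : Type) : infinite_set [set: T] ->
  exists p : T * T -> T, injective p.
Proof.
move=> Tinf; have [t _] := infinite_setN0 Tinf.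
have [p [_ pI]] := card_le_funP t (card_square Tinf).
by exists p => x y; exact: pI.
Qed.

(** Iterated pairing codes the sequences of a given length, and the length is
   recorded separately. *)
Lemma card_seq (T : Type) : infinite_set [set: T] ->
  exists e : seq T -> T, injective e.
Proof.
move=> Tinf; have [t _] := infinite_setN0 Tinf.
have [p pI] := card_square_type Tinf.
have /infiniteP/(card_le_funP t)[q [_ qI]] := Tinf.
pose code := foldr (fun x c => p (x, c)) t.
have code_inj (s s' : seq T) : size s = size s' -> code s = code s' -> s = s'.
  by elim: s s' => [|x s IH] [|x' s']//= [/IH ss'] /pI[-> /ss' ->].
exists (fun s => p (q (size s), code s)) => s s' /pI[/qI ss' /code_inj].
by apply; exact: ss'.
Qed.

(** * Regular ultrafilters *)

(** Index the finite sequences by [T] itself and let [Z a] consist of the codes of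
   the sequences that contain [a]. Finitely many of these sets have a common
   member, while the sequence with code [i] has only finitely many terms [a]. *)
Lemma exists_regular_ultrafilter (T : Type) : infinite_set [set: T] ->
  exists D : set_system T, regular_ultrafilter D.
Proof.
move=> Tinf; have [e eI] := @card_seq {classic T} Tinf.
pose F : set_system T := [set A | exists s0 : seq {classic T},
  forall s, {subset s0 <= s} -> A (e s)].
have FF : ProperFilter F.
  split; first by move=> [s /(_ s)]; apply.
  split; first by exists [::].
    move=> A B [s sA] [s' s'B]; exists (s ++ s') => r ss'r; split.
      by apply: sA => x xs; apply: ss'r; rewrite mem_cat xs.
    by apply: s'B => x xs; apply: ss'r; rewrite mem_cat xs orbT.
  by move=> A B AB [s sA]; exists s => r /sA/AB.
have [D [DU FD]] := ultraFilterLemma FF.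
exists D; split=> //.
exists (fun a : {classic T} => e @` [set s | a \in s]) => [a|A Ainf].
  apply: FD; exists [:: a] => s /(_ a); rewrite mem_head => as_.
  by exists s => //=; exact: as_.
apply/seteqP; split=> // i Zi; have [a Aa] := infinite_setN0 Ainf.
apply: Ainf.
have [s _ es] := Zi a Aa; apply: (@sub_finite_set _ _ [set` s]).
  by move=> b Ab; have [s' bs' es'] := Zi b Ab; rewrite (eI s s')// es es'.
exact: finite_seq.
Qed.

(** Each index lies in finitely many of the sets [Z a], so choosing an index of
   [A] in each [Z a] is a finite-to-one map from [T] to [A]; it embeds [T] in the
   product of [A] and the natural numbers. *)
Lemma regular_ultrafilter_uniform (T : Type) (D : set_system T) (A : set T) :
  infinite_set [set: T] -> regular_ultrafilter D -> D A -> [set: T] #<= A.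
Proof.
move=> Tinf [DU [Z DZ Zfin]] DA.
have fin i : finite_set [set a : {classic T} | Z a i].
  apply: contrapT => /(Zfin [set a | Z a i]) ZE.
  by have : @set0 T i by rewrite -ZE.
have /choice[s sP] : forall i, exists s : seq {classic T}, [set a | Z a i] = [set` s].
  by move=> i; apply/finite_seqP.
have /choice[f fP] : forall a, exists i, A i /\ Z a i.
  move=> a; have DAZ : D (A `&` Z a) by exact: filterI.
  by have [i [Ai Zi]] := filter_ex DAZ; exists i.
have inf : infinite_set A.
  move=> Afin; apply: Tinf.
  apply: (@sub_finite_set _ _ (\bigcup_(i in A) [set a | Z a i])).
    by move=> a _; have [] := fP a; exists (f a).
  exact: bigcup_finite.
apply: card_le_trans (card_square inf).
have /infiniteP AN := inf.
apply: (card_le_trans _ (card_leX (card_lexx A) AN)).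
pose g (a : {classic T}) := (f a, index a (s (f a))).
apply: (@card_le_fun _ _ _ _ g) => [a _|a b _ _ [ab]].
  by split=> //=; have [] := fP a.
have mem c : c \in s (f c).
  by have [_ Zc] := fP c; suff: [set` s (f c)] c by []; rewrite -sP.
rewrite ab => ib; rewrite -[a](@nth_index _ a a (s (f b))) -?ab//.
by rewrite ab ib (set_nth_default b) ?nth_index ?index_mem.
Qed.

(** * Cardinals as well-ordered types *)

Section cardinals.
Context d (N : orderType d).
Hypothesis Ncard : is_cardinal N.

Lemma cardinal_wf : well_founded (fun v w : N => v < w).
Proof.
have [Nwo _] := Ncard; apply: wf_of_minimal => P /(well_order_min Nwo)[z Pz zmin].
by exists z => // v vz /zmin; rewrite leNgt vz.
Qed.

Lemma order_total (v w : N) : [\/ v < w, v = w | w < v].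
Proof. by case: ltgtP => [||->]; [constructor 1|constructor 3|constructor 2]. Qed.

Lemma cardinal_compare (T : Type) (A : set T) :
  [set: N] #<= A \/ exists w : N, A #= [set v | v < w].
Proof.
case: (wf_compare cardinal_wf order_total [set: N] A) => [|[w _]]; first by left.
by rewrite setTI; right; exists w.
Qed.

End cardinals.

(** A last element would be a cofinal set by itself. *)
Lemma infinite_regular_nomax d (N : orderType d) (g : N) :
  infinite_regular N -> exists g', g < g'.
Proof.
move=> [[_ Ninf] [_ Nreg]]; apply: contrapT => nog; apply: Ninf.
apply: card_le_finite (finite_set1 g); apply: Nreg; split=> // h _.
by exists g => //; rewrite leNgt; apply/negP => gh; apply: nog; exists h.
Qed.

(** An unbounded set of indices is cofinal, hence of full size by regularity. *)
Lemma infinite_regular_bounded d (N : orderType d) (E : set N) :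
  infinite_regular N -> ~ (E #= [set: N]) -> exists g, forall h, g <= h -> ~ E h.
Proof.
move=> [_ [_ Nreg]] nE; apply: contrapT => nob; apply: nE; apply/card_eqPle.
split; first exact: card_leT.
apply: Nreg; split=> // g _; apply: contrapT => ng; apply: nob.
by exists g => h gh Eh; apply: ng; exists h.
Qed.

(** * Compactness with respect to ultrafilters *)

Lemma ultra_fmap (I Y : Type) (x : I -> Y) (D : set_system I) :
  UltraFilter D -> UltraFilter (x @ D).
Proof.
move=> DU; split; first exact: fmap_proper_filter.
move=> G GF DG; apply/seteqP; split=> // A GA.
have [//|nA] := in_ultra_setVsetC (x @^-1` A) DU.
have GnA : G (~` A) by exact: DG.
by have [y []] := filter_ex (filterI GA GnA).
Qed.

Section topology.
Context (X : topologicalType).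

Lemma D_compact_pseudocompact (I : Type) (D : set_system I) :
  Filter D -> D_compact X D -> D_pseudocompact X D.
Proof.
move=> FD Dc O Oo; have /choice[x Ox] i := (Oo i).2.
have [l xl] := Dc x; exists l => U lU.
have DU : D (x @^-1` U) by exact: xl.
by apply: filterS DU => i Ui; exists (x i).
Qed.

Section regular.
Context (L : Type) (D : set_system L).
Hypothesis Linf : infinite_set [set: L].
Hypothesis Dreg : regular_ultrafilter D.

(** Code the members of [F] by elements of [L] and let [G i] consist of those
   whose code [a] satisfies [Z a i]. This turns a limit along [D] into a
   statement about finite subfamilies of [F]. *)
Lemma regular_finite_parts (F : set (set X)) : F #<= [set: L] ->
  exists2 G : L -> set (set X),
    forall i, G i `<=` F /\ finite_set (G i) &
    forall U, F U -> D [set i | G i U].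
Proof.
move=> FL; have [DU [Z DZ Zfin]] := Dreg.
have [l _] := infinite_setN0 Linf.
have [c [_ cI]] := card_le_funP l FL.
exists (fun i => [set U | F U /\ Z (c U) i]) => [i|U FU].
  split; first by move=> U [].
  apply: (@card_le_finite _ _ _ [set a | Z a i]).
    by apply: (@card_le_fun _ _ _ _ c) => [U []|U V [FU _] [FV _]] //; exact: cI.
  apply: contrapT => /(Zfin [set a | Z a i]) ZE.
  by have : @set0 L i by rewrite -ZE.
by apply: filterS (DZ (c U)) => i ZUi.
Qed.

(** Choose [x i] outside the finite part [G i]: a limit along [D] belongs to some
   member [U] of the cover, while [U] belongs to [G i] for almost all [i]. *)
Lemma D_compact_initially_compact : D_compact X D -> initially_compact X L.
Proof.
move=> Dc F FL Fo Fcov; have [DU _] := Dreg; apply: contrapT => nfin.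
have [G GP GD] := regular_finite_parts FL.
have /choice[x xP] : forall i, exists x, ~ (\bigcup_(U in G i) U) x.
  move=> i; apply: contrapT => nx; apply: nfin; exists (G i).
  have [GF Gfin] := GP i; split=> //; apply/seteqP; split=> // y _.
  by apply: contrapT => ny; apply: nx; exists y.
have [l xl] := Dc x.
have [U FU Ul] : (\bigcup_(U in F) U) l by rewrite Fcov.
have xU : D (x @^-1` U) by apply: xl; apply: open_nbhs_nbhs; split=> //; exact: Fo.
have [i [xiU GiU]] := filter_ex (filterI xU (GD U FU)).
by apply: (xP i); exists U.
Qed.

(** The same argument with open sets [O i] missing the union of [G i]. *)
Lemma D_pseudocompact_weakly_initially_compact :
  D_pseudocompact X D -> weakly_initially_compact X L.
Proof.
move=> Dc F FL Fo Fcov; have [DU _] := Dreg; apply: contrapT => nfin.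
have [G GP GD] := regular_finite_parts FL.
have /choice[O OP] : forall i, exists O : set X,
    (open O /\ O !=set0) /\ O `&` \bigcup_(U in G i) U = set0.
  move=> i; apply: contrapT => nO; apply: nfin; exists (G i).
  have [GF Gfin] := GP i; split=> // O O0 Oo; apply/set0P/eqP => OG.
  by apply: nO; exists O.
have [l Ol] := Dc O (fun i => (OP i).1).
have [U FU Ul] : (\bigcup_(U in F) U) l by rewrite Fcov.
have OU := Ol U (open_nbhs_nbhs (conj (Fo U FU) Ul)).
have [i [[y [Uy Oy]] GiU]] := filter_ex (filterI OU (GD U FU)).
by have : @set0 X y by rewrite -(OP i).2; split=> //; exists U.
Qed.

End regular.

Lemma initially_compact_weakly (L : Type) :
  initially_compact X L -> weakly_initially_compact X L.
Proof.
move=> ic F FL Fo Fcov; have [G [GF Gfin Gcov]] := ic F FL Fo Fcov.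
by exists G; split=> // O [x Ox] _; exists x; rewrite Gcov.
Qed.

(** An index set carries a regular ultrafilter, all of whose members have full
   size, so a limit along it is an accumulation point. *)
Lemma D_pseudocompact_accumulation (L : Type)
    (P : forall d (N : orderType d), (N -> set X) -> Prop) :
  (forall (I : Type) (D : set_system I),
     [set: I] #<= [set: L] -> UltraFilter D -> D_pseudocompact X D) ->
  open_accumulation L (@infinite_cardinal) P.
Proof.
move=> Dc d N [_ Ninf] NL O Oo _.
have [D Dreg] := exists_regular_ultrafilter Ninf.
have [x xP] := Dc N D NL Dreg.1 O Oo; exists x => U xU.
apply/card_eqPle; split; first exact: card_leT.
apply: regular_ultrafilter_uniform Dreg _ => //.
by rewrite (_ : [set g | _] = [set i | U `&` O i !=set0]) //;
  [exact: xP | apply/seteqP; split=> g /=; rewrite setIC].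
Qed.

(** If every point had a neighbourhood missing a tail of the sequence, the
   complements of the closures of the tails would be an increasing open cover
   without a dense member. *)
Lemma weakly_initially_compact_accumulation (L : Type)
    (P : forall d (N : orderType d), (N -> set X) -> Prop) :
  weakly_initially_compact X L -> open_accumulation L (@infinite_regular) P.
Proof.
move=> wic d N Nreg NL O Oo _.
pose tail g := \bigcup_(h in [set h | g <= h]) O h.
pose V g := ~` closure (tail g).
apply: contrapT => noacc.
have Vcov : \bigcup_(U in range V) U = [set: X].
  apply/seteqP; split=> // x _; apply: contrapT => nVx; apply: noacc; exists x.
  move=> U xU; apply: contrapT => /(infinite_regular_bounded Nreg)[g gP].
  apply: nVx; exists (V g); first by exists g.
  by move=> /(_ U xU)[y [[h gh Ohy] Uy]]; apply: (gP h gh); exists y.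
have [|_ [g _ <-]|G [GV Gfin Gdense]] := wic (range V) _ _ Vcov.
- by apply: card_le_trans NL; exact: card_image_le.
- exact/closed_openC/closed_closure.
(* the sets V g increase with g, so a finite subfamily lies below one of them *)
have [g gP] : exists g, forall U, G U -> U `<=` V g.
  have : exists s : seq {classic set X}, G = [set` s] by exact/finite_seqP.
  case=> s; have [g0 _] := infinite_setN0 Nreg.1.2.
  elim: s G GV {Gfin Gdense} => [|U s IH] G GV GE; first by exists g0 => U; rewrite GE.
  have [|g gP] := IH [set` s] _ erefl.
    by move=> A As; apply: GV; rewrite GE /= inE As orbT.
  have [h _ hU] : (range V) U by apply: GV; rewrite GE /= mem_head.
  have Vmono a b : a <= b -> V a `<=` V b.
    move=> ab; apply: subsetC; apply: closureS => y [c bc Oc].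
    by exists c => //=; exact: le_trans ab bc.
  exists (Order.max g h) => A; rewrite GE /= inE => /orP[/eqP ->|As].
    by rewrite -hU; apply: Vmono; rewrite le_max lexx orbT.
  by apply: (subset_trans (gP A As)); apply: Vmono; rewrite le_max lexx.
have [Og0 Og] : open (O g) /\ O g !=set0 by exact: Oo.
have [y [Oy [U GU Uy]]] := Gdense (O g) Og Og0.
by apply: (gP U GU y Uy); apply: subset_closure; exists g => /=.
Qed.

Lemma lambda_bounded_D_compact (L I : Type) (D : set_system I) :
  lambda_bounded X L -> [set: I] #<= [set: L] -> UltraFilter D -> D_compact X D.
Proof.
move=> Xb IL DU x.
have xK : compact (closure (range x)).
  by apply: Xb; apply: card_le_trans IL; exact: card_image_le.
have xDU : UltraFilter (x @ D) by exact: ultra_fmap.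
move: xK; rewrite compact_ultra => /(_ (x @ D) xDU)[|l [_ xl]]; last by exists l.
apply: (filterS (@subset_closure _ (range x))).
by rewrite /fmap /=; apply: (filterS _ filterT) => i _; exists i.
Qed.

End topology.

(** * Cofinalities *)

(** Cofinalities below [L] are realised by its initial segments; the name lets the
   subtype carry the induced order. *)
Definition segment d (N : orderType d) (w : N) : Type := {v : N | v < w}.

HB.instance Definition _ d (N : orderType d) (w : N) := SubChoice.on (segment w).
HB.instance Definition _ d (N : orderType d) (w : N) :=
  [SubChoice_isSubOrder of segment w by <: with d].

Lemma card_segment d (N : orderType d) (w : N) :
  [set: segment w] #= [set v | v < w].
Proof.
apply/card_eqPle; split.
  apply: (@card_le_fun _ _ _ _ (fun v : segment w => val v)) => [v _|u v _ _].
    exact: valP v.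
  exact: val_inj.
have [->|/set0P[v0 v0w]] := eqVneq [set v | v < w] set0; first exact: card_ge0.
pose v1 : segment w := Sub v0 v0w.
apply: (@card_le_fun _ _ _ _ (fun v => insubd v1 v)) => // u v /= uw vw.
by move/(congr1 val); rewrite !val_insubd uw vw.
Qed.

Lemma well_order_segment d (N : orderType d) (w : N) :
  well_order (<=%O : rel N) -> well_order (<=%O : rel (segment w)).
Proof.
move=> Nwo; apply: antisymmetric_well_order => [x y|A [x Ax]].
  exact: le_anti.
have [|z [y Ay yz] zmin] := @well_order_min N _ Nwo (val @` [set y | y \in A]).
  by exists (val x), x.
by exists y; split=> // u Au; rewrite leEsub yz; apply: zmin; exists u.
Qed.

(** Take the least [w] such that some cofinal set has the size of the segment below
   [w]: minimality makes this segment a cardinal. If there is no such [w], every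
   cofinal set is at least as large as [L]. *)
Lemma exists_cofinality d (X : porderType d) dL (L : orderType dL)
    (A C0 : set X) : is_cardinal L -> cofinal A C0 -> C0 #<= [set: L] ->
  exists d' (M : orderType d'),
    [/\ is_cardinal M, [set: M] #<= [set: L] & cofinality A M].
Proof.
move=> Lcard C0cof C0L.
pose P : set L := [set w | exists2 C, cofinal A C & C #= [set v | v < w]].
have LP D : cofinal A D -> [set: L] #<= D \/ exists2 t, P t & D #= [set v | v < t].
  move=> Dcof; have [LD|[t Dt]] := cardinal_compare Lcard D; first by left.
  by right; exists t => //; exists D.
have [P0|nP] := pselect (P !=set0); last first.
  have LD D : cofinal A D -> [set: L] #<= D.
    by move=> /LP[//|[t Pt _]]; case: nP; exists t.
  exists dL, L; split=> //; split=> //; exists C0 => //.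
  by apply/card_eqPle; split=> //; exact: LD.
have [w [C Ccof /card_eqPle[Cw wC]] wmin] := wf_minimal (cardinal_wf Lcard) P0.
have /card_eqPle[sw ws] := card_segment w.
exists dL, (segment w); split.
- split; first by apply: well_order_segment; exact: Lcard.1.
  move=> a wa; apply: (wmin (val a) (valP a)); exists C => //.
  apply/card_eqPle; split; last first.
    apply: card_le_trans wC; apply: subset_card_le => v /= va.
    exact: lt_trans va (valP a).
  apply: card_le_trans Cw (card_le_trans ws (card_le_trans wa _)).
  by apply: (@card_le_fun _ _ _ _ (fun v : segment w => val v)) => // u v _ _ /val_inj.
- exact: card_le_trans sw (card_leT _).
- split; first by exists C => //; apply/card_eqPle; split; [exact: card_le_trans Cw ws|exact: card_le_trans sw wC].
  move=> D /LP[LD|[t Pt /card_eqPle[_ tD]]]; apply: card_le_trans sw _.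
    exact: card_le_trans (card_leT _) LD.
  apply: card_le_trans tD; apply: subset_card_le => v /= vw.
  apply: lt_le_trans vw _; rewrite leNgt; apply/negP => tw; exact: wmin tw Pt.
Qed.

Section total.
Context d (X : porderType d).
Hypothesis Xtot : total (<=%O : rel X).

Lemma total_leVgt (x y : X) : x <= y \/ y < x.
Proof.
have [xy|xy] := boolP (x <= y); [by left|right].
rewrite lt_neqAle; apply/andP; split; last by move: (Xtot x y); rewrite (negbTE xy).
by apply: contraNneq xy => ->.
Qed.

Lemma finite_has_max (C : set X) : finite_set C -> C !=set0 -> has_max C.
Proof.
move=> /finite_seqP[s ->] [x0]; elim: s x0 => [//|x s IH] x0 _.
have [[m ms mmax]|nm] := pselect (has_max [set` s]); last first.
  exists x; rewrite /= ?mem_head// => y; rewrite /= inE => /orP[/eqP->//|ys].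
  by case: nm; exact: IH ys.
have [xm|mx] := total_leVgt x m.
  exists m; first by rewrite /= inE; apply/orP; right.
  by move=> y; rewrite /= inE => /orP[/eqP->//|/mmax].
exists x; rewrite /= ?mem_head// => y; rewrite /= inE => /orP[/eqP->//|/mmax ym].
exact: le_trans ym (ltW mx).
Qed.

Lemma nomax_above (A : set X) (x : X) : ~ has_max A -> A x ->
  exists2 y, A y & x < y.
Proof.
move=> nA Ax; apply: contrapT => ny; apply: nA; exists x => // y Ay.
by have [//|xy] := total_leVgt y x; case: ny; exists y.
Qed.

Context dN (N : orderType dN) (A : set X).
Hypothesis Acof : cofinality A N.

Lemma cofinality_infinite : A !=set0 -> ~ has_max A -> infinite_set [set: N].
Proof.
move=> [a Aa] nA; have [[C [CA Ccof] /card_eqPle[CN _]] _] := Acof.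
move=> /(card_le_finite CN) Cfin; apply: nA.
have [c0 Cc0 _] := Ccof a Aa.
have [m Cm mmax] := finite_has_max Cfin (ex_intro _ c0 Cc0).
exists m; first exact: CA.
by move=> x /Ccof[c /mmax cm xc]; exact: le_trans xc cm.
Qed.

(** At each index fewer than [N] values have been chosen, so their images under
   [h] are not cofinal and a next value above all of them is available. The
   function [h] reserves room between consecutive terms. *)
Lemma cofinal_sequence (h : X -> X) : is_cardinal N -> A !=set0 ->
  (forall x, A x -> A (h x)) ->
  exists a : N -> X, [/\ forall g, A (a g), forall x, A x -> exists g, x <= a g
    & forall g g', g < g' -> h (a g) < a g'].
Proof.
move=> Ncard [x0 Ax0] hA; have [[C [CA Ccof] /card_eqPle[CN _]] Amin] := Acof.
have [f fC] := card_le_onto x0 CN.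
pose next (g : N) (S : set X) :=
  [set y | [/\ A y, A (f g) -> f g <= y & forall z, S z -> h z < y]].
have [a aE] := wf_rec (cardinal_wf Ncard) (fun g S => xget x0 (next g S)).
have aP g : next g (a @` [set v | v < g]) (a g).
  elim/(well_founded_ind (cardinal_wf Ncard)): g => g IH.
  rewrite [a g]aE; apply: xgetPex.
  have [y0 Ay0 y0P] : exists2 y, A y & forall v, v < g -> h (a v) < y.
    apply: contrapT => ny; apply: (Ncard.2 g).
    pose S := (h \o a) @` [set v | v < g].
    apply: (card_le_trans (Amin S _)); last exact: card_image_le.
    split; first by move=> _ [v /IH[Av _ _] <-]; exact: hA.
    move=> y Ay; apply: contrapT => nS; apply: ny; exists y => // v vg.
    by have [yv|//] := total_leVgt y (h (a v)); case: nS; exists (h (a v)) => //; exists v.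
  have [fy|yf] := total_leVgt (f g) y0.
    by exists y0; split=> // _ [v vg <-]; exact: y0P.
  have [Af|nAf] := pselect (A (f g)).
    by exists (f g); split=> // _ [v vg <-]; exact: lt_trans (y0P v vg) yf.
  by exists y0; split=> // _ [v vg <-]; exact: y0P.
exists a; split=> [g|x /Ccof[c Cc xc]|g g' gg'].
- by have [] := aP g.
- have [g _ fg] := fC c Cc; exists g; apply: le_trans xc _.
  by have [_ + _] := aP g; rewrite fg; apply; exact: CA.
- by have [_ _] := aP g'; apply; exists g.
Qed.

(** A cofinal set of indices yields a cofinal set of terms of a cofinal sequence. *)
Lemma cofinality_regular : infinite_cardinal N -> A !=set0 -> infinite_regular N.
Proof.
move=> Ninf A0; split=> //.
have [a [aA acof ainc]] := cofinal_sequence Ninf.1 A0 (fun _ => id).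
split.
  by exists [set: N]; [split=> // x _; exists x|exact: card_eqxx].
move=> C [_ Ccof]; apply: card_le_trans (card_image_le a C).
apply: Acof.2; split=> [_ [g _ <-]//|x /acof[g xg]].
have [c Cc gc] := Ccof g I; exists (a c); first by exists c.
apply: le_trans xg _; move: gc; rewrite le_eqVlt => /orP[/eqP->//|/ainc/ltW//].
Qed.

End total.

(** * Generalized ordered spaces *)

(** The reversed order with the same topology: upper bounds become lower bounds and
   coinitialities become cofinalities, definitionally, so that one-sided lemmas
   apply to both sides of a cut. *)
HB.instance Definition _ d (X : POrderedTopological.type d) :=
  Topological.copy (X^d) X.

Lemma GO_space_dual d (X : POrderedTopological.type d) :
  GO_space X -> GO_space X^d.
Proof.
move=> [Xtot Xh [B Bbasis Bconvex]]; split=> //.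
  by move=> x y; exact: Xtot.
exists B => // V /Bconvex Vc x y z Vx Vz xy yz; exact: (Vc z y x).
Qed.

Section go.
Context d (X : POrderedTopological.type d).
Hypothesis hX : GO_space X.

Let Xtot : total (<=%O : rel X). Proof. by case: hX. Qed.

Lemma convex_nbhs (x : X) (U : set X) : nbhs x U ->
  exists V, [/\ nbhs x V, order_convex V, V x & V `<=` U].
Proof.
have [_ _ [B [Bo Bbasis] Bconvex]] := hX => /Bbasis[V [BV Vx] VU].
exists V; split=> //; last exact: Bconvex.
by apply: open_nbhs_nbhs; split=> //; exact: Bo.
Qed.

(** A convex neighbourhood of [x] that misses [a] stays on the side of [x]. *)
Lemma open_lt (a : X) : open [set y : X | y < a].
Proof.
rewrite openE => x /= xa; have [_ Xh _] := hX.
have [|V [xV Vc Vx Va]] := @convex_nbhs x (~` [set a]).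
  apply: open_nbhs_nbhs; split; last by move=> xE; rewrite xE ltxx in xa.
  exact/closed_openC/accessible_closed_set1/hausdorff_accessible.
apply: (filterS _ xV) => y Vy /=.
have [ay|//] := total_leVgt Xtot a y.
by case: (Va a _ erefl); exact: (Vc x a y Vx Vy (ltW xa) ay).
Qed.

End go.

Lemma open_gt d (X : POrderedTopological.type d) (a : X) :
  GO_space X -> open [set y : X | a < y].
Proof. by move=> /GO_space_dual hX; exact: (open_lt hX a). Qed.

(** One half of the absence of gaps and pseudo-gaps; the other half is the same
   statement for the reversed order. *)
Definition no_cofinal_cut d (X : POrderedTopological.type d) (L : Type) : Prop :=
  forall (A B : set X) dM (M : orderType dM), open_cut A B -> A !=set0 ->
  ~ has_max A -> is_cardinal M -> [set: M] #<= [set: L] -> ~ cofinality A M.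

Lemma open_cut_dual d (X : POrderedTopological.type d) (A B : set X) :
  open_cut A B -> @open_cut _ X^d B A.
Proof.
move=> [Ao Bo AB ltAB]; split=> //; first by rewrite -AB; exact: setUC.
by move=> b a Bb Aa; exact: ltAB.
Qed.

(** A cut whose lower side has no maximum is a pseudo-gap or a gap according to
   whether the upper side has a minimum. *)
Lemma no_gap_cofinal_cut d (X : POrderedTopological.type d) (L : Type) :
  GO_space X -> no_gap_of_type_le X L -> no_cofinal_cut X L.
Proof.
move=> [Xtot _ _] nogap A B dM M AB A0 Amax Mcard ML Acof.
have [ngap npseudo] := nogap A B dM M ML.
have [Bmin|nBmin] := pselect (has_min B).
  apply: npseudo; split; last by split=> //; left.
  by split=> //; [case: Bmin => b; exists b|right].
apply: ngap; split; first by split.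
split; last by left.
by split=> //; exact: cofinality_infinite Acof A0 Amax.
Qed.

Lemma no_gap_dual d (X : POrderedTopological.type d) (L : Type) :
  no_gap_of_type_le X L -> @no_gap_of_type_le _ X^d L.
Proof.
move=> nogap A B dM M ML; have [ngap npseudo] := nogap B A dM M ML; split.
  move=> [[AB Amax Bmin] [Minf Mcof]]; apply: ngap; split.
    by split=> //; exact: (open_cut_dual AB).
  by split=> //; case: Mcof; [right|left].
move=> [[AB A0 B0 AB'] [Mcard Mcof]]; apply: npseudo; split.
  split=> //; first exact: (open_cut_dual AB).
  by case: AB' => -[]; [right|left].
by split=> //; case: Mcof; [right|left].
Qed.

Lemma cofinal_cut_no_gap d (X : POrderedTopological.type d) (L : Type) :
  no_cofinal_cut X L -> @no_cofinal_cut _ X^d L -> no_gap_of_type_le X L.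
Proof.
move=> nX nXd A B dM M ML; split.
  move=> [[AB Amax Bmin] [[Mcard Minf] Mcof]].
  have ne (C D : set X) : C #= [set: M] -> C `<=` D -> D !=set0.
    move=> /card_eqPle[_ MC] CD.
    by have [x Cx] := card_le_nonempty MC (infinite_setN0 Minf); exists x; exact: CD.
  case: Mcof => [Acof|Bcoi].
    have [[C [CA _] CM] _] := Acof.
    exact: nX AB (ne C A CM CA) Amax Mcard ML Acof.
  have [[C [CB _] CM] _] := Bcoi.
  exact: nXd (open_cut_dual AB) (ne C B CM CB) Bmin Mcard ML Bcoi.
move=> [[AB A0 B0 AB'] [Mcard Mcof]].
case: AB' => -[Am Bm].
  case: Mcof => -[] // _ Bcoi.
  exact: nXd (open_cut_dual AB) B0 Bm Mcard ML Bcoi.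
case: Mcof => -[] // _ Acof.
exact: nX AB A0 Am Mcard ML Acof.
Qed.

(** * Open cuts without accumulation points *)

Section cuts.
Context d (X : POrderedTopological.type d) (L : Type).
Hypothesis hX : GO_space X.

Let Xtot : total (<=%O : rel X). Proof. by case: hX. Qed.

(** The limit of a cofinal sequence of [A] would be the maximum of [A], or belong
   to the neighbourhood [B], which contains no term of the sequence. *)
Lemma monotone_no_cofinal_cut :
  monotone_sequences_converge X L -> no_cofinal_cut X L.
Proof.
move=> mono A B dM M [Ao Bo AB ltAB] A0 Amax Mcard ML Acof.
have Minf := cofinality_infinite Xtot Acof A0 Amax.
have Mreg : infinite_regular M by exact: (cofinality_regular Xtot Acof).
have [a [aA acof ainc]] := cofinal_sequence Xtot Acof Mcard A0 (fun _ => id).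
have [s [sub _] scvg] := (mono dM M Mreg ML a).1 ainc.
have [As|Bs] : (A `|` B) s by rewrite [A `|` B]AB.
  apply: Amax; exists s => // x /acof[g xg].
  by apply: le_trans xg _; apply: sub; exists g.
have [g gB] := scvg B (open_nbhs_nbhs (conj Bo Bs)).
have [g' /gB Bg'] := infinite_regular_nomax g Mreg.
by have := ltAB _ _ (aA g') Bg'; rewrite ltxx.
Qed.

(** A point of [A] lies below some [a g] and a point of [B] above all of them,
   so no point can accumulate sets chosen from further and further in [A]. *)
Lemma cofinal_cut_no_accumulation (A B : set X) dM (M : orderType dM)
    (a : M -> X) (O : M -> set X) (x : X) :
  open_cut A B -> ~ has_max A -> infinite_cardinal M ->
  (forall x, A x -> exists g, x <= a g) ->
  (forall g g', g < g' -> a g < a g') ->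
  (forall g, O g `<=` [set y | A y /\ a g < y]) ->
  ~ forall U, nbhs x U -> [set g | O g `&` U !=set0] #= [set: M].
Proof.
move=> [Ao Bo AB ltAB] Amax [Mcard Minf] acof ainc OA xacc.
have [Ax|Bx] : (A `|` B) x by rewrite [A `|` B]AB.
  have [y Ay xy] := nomax_above Xtot Amax Ax.
  have [g yg] := acof y Ay; apply: (Mcard.2 g).
  have /card_eqPle[_] :=
    xacc _ (open_nbhs_nbhs (conj (open_lt hX y : open [set z | z < y]) xy)).
  move/card_le_trans; apply; apply: subset_card_le => h /= [z [/OA[_ hz] /= zy]].
  rewrite ltNge; apply/negP; rewrite le_eqVlt => /orP[/eqP gh|/ainc gh].
    by have := lt_trans hz (lt_le_trans zy yg); rewrite gh ltxx.
  by have := lt_trans (lt_trans hz (lt_le_trans zy yg)) gh; rewrite ltxx.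
apply: Minf; have /card_eqPle[_] := xacc B (open_nbhs_nbhs (conj Bo Bx)).
move/card_le_finite; apply; rewrite (_ : [set g | _] = set0).
  exact: finite_set0.
apply/seteqP; split=> // g [y [/OA[Ay _] By]].
by have := ltAB y y Ay By; rewrite ltxx.
Qed.

Lemma decreasing_no_cofinal_cut :
  open_accumulation L (@infinite_regular) (@decreasing_sets X) ->
  no_cofinal_cut X L.
Proof.
move=> acc A B dM M AB A0 Amax Mcard ML Acof.
have Minf := cofinality_infinite Xtot Acof A0 Amax.
have Mreg : infinite_regular M by exact: (cofinality_regular Xtot Acof).
have [a [aA acof ainc]] := cofinal_sequence Xtot Acof Mcard A0 (fun _ => id).
have [Ao _ _ _] := AB.
have [||x xacc] := acc dM M Mreg ML (fun g => A `&` [set y | a g < y]).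
- move=> g; split; first by apply: openI => //; exact: open_gt.
  by have [g' /ainc gg'] := infinite_regular_nomax g Mreg; exists (a g').
- move=> g g' gg'; split=> [y [Ay /= gy]|sub].
    by split=> //=; exact: lt_trans (ainc _ _ gg') gy.
  by have [_ /=] := sub (a g) (conj (aA g) (ainc _ _ gg')); rewrite ltxx.
by apply: (cofinal_cut_no_accumulation AB Amax Mreg.1 acof ainc _ xacc) => g y [].
Qed.

Lemma disjoint_no_cofinal_cut :
  open_accumulation L (@infinite_regular) (@disjoint_sets X) ->
  no_cofinal_cut X L.
Proof.
move=> acc A B dM M AB A0 Amax Mcard ML Acof.
have Minf := cofinality_infinite Xtot Acof A0 Amax.
have Mreg : infinite_regular M by exact: (cofinality_regular Xtot Acof).
have [Ao Bo AB' ltAB] := AB.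
have /choice[n nP] : forall x, exists y, A x -> A y /\ x < y.
  move=> x; have [Ax|nAx] := pselect (A x); last by exists x.
  by have [y Ay xy] := nomax_above Xtot Amax Ax; exists y.
have nA x : A x -> A (n (n x)) by move=> /nP[/nP[]].
(* each term exceeds n (n (a g)) for all earlier g, which makes the intervals
   from a g to n (n (a g)) disjoint, and n (a g) is a point of such an interval *)
have [a [aA acof anext]] := cofinal_sequence Xtot Acof Mcard A0 nA.
have an g : a g < n (a g) < n (n (a g)).
  by have [An ->] := nP _ (aA g); have [_ ->] := nP _ An.
have ainc g g' : g < g' -> a g < a g'.
  move=> /anext; apply: lt_trans; have /andP[] := an g; exact: lt_trans.
have [||x xacc] :=
    acc dM M Mreg ML (fun g => [set y | a g < y] `&` [set y | y < n (n (a g))]).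
- move=> g; split; first by apply: openI; [exact: open_gt|exact: open_lt].
  by exists (n (a g)); have /andP[] := an g.
- have lt g g' y : g < g' -> y < n (n (a g)) -> ~ a g' < y.
    move=> /anext gg' yg g'y.
    by have := lt_trans (lt_trans yg gg') g'y; rewrite ltxx.
  move=> g g' _ _ [y [[/= gy yg] [/= g'y yg']]].
  by case: (ltgtP g g') => // [/lt/(_ yg)//|/lt/(_ yg')//].
apply: (cofinal_cut_no_accumulation AB Amax Mreg.1 acof ainc _ xacc).
move=> g y [/= gy yg]; split=> //.
have [//|By] : (A `|` B) y by rewrite [A `|` B]AB'.
by have := lt_trans yg (ltAB _ _ (nA _ (aA g)) By); rewrite ltxx.
Qed.

End cuts.

(** * Boundedness *)

Section bounded.
Context d (X : POrderedTopological.type d) (L : Type).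
Hypothesis hX : GO_space X.

Let Xtot : total (<=%O : rel X). Proof. by case: hX. Qed.

(** Compactness gives a cluster point of the tails. By monotonicity it is the
   supremum, and a convex neighbourhood that contains one term contains all
   later ones. *)
Lemma bounded_increasing_converge dN (N : orderType dN) (x : N -> X) :
  lambda_bounded X L -> infinite_regular N -> [set: N] #<= [set: L] ->
  (forall a b, a < b -> x a < x b) ->
  exists2 s, supremums (range x) s & seq_cvg x s.
Proof.
move=> Xb Nreg NL xinc.
pose F : set_system X := [set U | exists g, forall h, g < h -> U (x h)].
have FF : ProperFilter F.
  split; first by move=> [g gP]; have [h /gP] := infinite_regular_nomax g Nreg.
  split.
  - by have [g _] := infinite_setN0 Nreg.1.2; exists g.
  - move=> U V [g gU] [h hV]; exists (Order.max g h) => k.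
    by rewrite gt_max => /andP[/gU ? /hV ?].
  - by move=> U V UV [g gU]; exists g => h /gU/UV.
have [|s [_ sF]] := Xb (range x) (card_le_trans (card_image_le _ _) NL) F FF.
  have [g _] := infinite_setN0 Nreg.1.2.
  by exists g => h _; apply: subset_closure; exists h.
have sub g : x g <= s.
  have [//|sg] := total_leVgt Xtot (x g) s.
  have [||y []] := sF [set y | x g < y] [set y | y < x g].
  - by exists g => h; exact: xinc.
  - by apply: open_nbhs_nbhs; split=> //; exact: open_lt.
  - by move=> /= gy yg; have := lt_trans gy yg; rewrite ltxx.
have sup y : (forall g, x g <= y) -> s <= y.
  move=> xy; have [//|ys] := total_leVgt Xtot s y.
  have [||z []] := sF (range x) [set z | y < z].
  - by have [g _] := infinite_setN0 Nreg.1.2; exists g => h _; exists h.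
  - by apply: open_nbhs_nbhs; split=> //; exact: open_gt.
  - by move=> [g _ <-] /= yg; have := lt_le_trans yg (xy g); rewrite ltxx.
exists s.
  by split=> [_ [g _ <-]//|y yub]; apply: sup => g; apply: yub; exists g.
move=> U sU; have [V [sV Vc Vs VU]] := convex_nbhs hX sU.
have [|z [[g _ <-] Vg]] := sF (range x) V _ sV.
  by have [g _] := infinite_setN0 Nreg.1.2; exists g => h _; exists h.
by exists g => h gh; apply: VU; exact: (Vc (x g) (x h) s Vg Vs (ltW (xinc _ _ gh))).
Qed.

(** The set of points below [F] is open because a convex neighbourhood of such a
   point [p] that reaches a point above [F] contains an interval in [F], and [p],
   not being a limit, has a neighbourhood outside [F]. *)
Lemma divergent_open (F : set_system X) : UltraFilter F ->
  (forall p : X, ~ F --> p) ->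
  (forall p, F [set y | p < y] \/ F [set y | y < p]) /\
  open [set p | F [set y | p < y]].
Proof.
move=> FU Fdiv.
have side p : F [set y | p < y] \/ F [set y | y < p].
  have [|np] := in_ultra_setVsetC [set y | p < y] FU; first by left.
  have [|np'] := in_ultra_setVsetC [set y | y < p] FU; first by right.
  case: (Fdiv p) => U pU; apply: (filterS _ (filterI np np')) => y [/= py yp].
  have [yp'|//] := total_leVgt Xtot y p.
  move: yp'; rewrite le_eqVlt => /orP[/eqP ->|//]; exact: nbhs_singleton.
split=> //; rewrite openE => p /= Fp.
have [U pU nFU] : exists2 U, nbhs p U & ~ F U.
  apply: contrapT => nU; apply: (Fdiv p) => U pU.
  by apply: contrapT => nFU; apply: nU; exists U.
have [V [pV Vc Vp VU]] := convex_nbhs hX pU.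
apply: (filterS _ pV) => y Vy /=; have [//|Fy] := side y.
exfalso; apply: nFU; apply: (filterS _ (filterI Fp Fy)) => z [/= pz zy].
by apply: VU; exact: (Vc p z y Vp Vy (ltW pz) (ltW zy)).
Qed.

End bounded.

Lemma divergent_cut d (X : POrderedTopological.type d) (F : set_system X) :
  GO_space X -> UltraFilter F -> (forall p : X, ~ F --> p) ->
  open_cut [set p | F [set y | p < y]] [set p | F [set y | y < p]].
Proof.
move=> hX FU Fdiv; have [side Ao] := divergent_open hX FU Fdiv.
have [_ Bo] := divergent_open (GO_space_dual hX) FU Fdiv.
split=> //; first by apply/seteqP; split=> // p _; exact: side.
move=> a b /= Fa Fb; have [y [/= ay yb]] := filter_ex (filterI Fa Fb).
exact: lt_trans ay yb.
Qed.

(** If the closure of a small set [S] belongs to a divergent ultrafilter that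
   lives on the lower side of its cut, then [S] is cofinal in that side. *)
Lemma divergent_no_lower d (X : POrderedTopological.type d) dL (L : orderType dL)
    (S : set X) (F : set_system X) :
  GO_space X -> is_cardinal L -> no_cofinal_cut X L -> S #<= [set: L] ->
  UltraFilter F -> (forall p : X, ~ F --> p) -> F (closure S) ->
  ~ F [set p | F [set y | p < y]].
Proof.
move=> hX Lcard nocut SL FU Fdiv FS; set A := [set p | _] => FA.
have cut := divergent_cut hX FU Fdiv; have [Ao _ _ _] := cut.
have Scof : cofinal A (S `&` A).
  split; first by move=> x [].
  move=> a Aa; have [y [[ay Ay] Sy]] := filter_ex (filterI (filterI Aa FA) FS).
  have oy : nbhs y ([set y | a < y] `&` A).
    by apply: open_nbhs_nbhs; split=> //; apply: openI => //; exact: open_gt.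
  have [c [Sc [/= ac Ac]]] := Sy _ oy.
  by exists c => //; exact: ltW.
have SAL : S `&` A #<= [set: L].
  by apply: card_le_trans SL; apply: subset_card_le => x [].
have [dM [M [Mcard ML Acof]]] := exists_cofinality Lcard Scof SAL.
apply: nocut cut (filter_ex FA) _ Mcard ML Acof => -[m Am mmax].
have [y [/= my Ay]] := filter_ex (filterI Am FA).
by have := lt_le_trans my (mmax y Ay); rewrite ltxx.
Qed.

Lemma no_gap_bounded d (X : POrderedTopological.type d) dL (L : orderType dL) :
  GO_space X -> is_cardinal L -> no_gap_of_type_le X L -> lambda_bounded X L.
Proof.
move=> hX Lcard nogap S SL; rewrite compact_ultra => F FU FS.
apply: contrapT => nlim.
have Fdiv (p : X) : ~ F --> p.
  move=> Fp; apply: nlim; exists p; split=> //.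
  apply: closed_closure => U pU.
  by have [y [Sy Uy]] := filter_ex (filterI FS (Fp U pU)); exists y.
have nA := divergent_no_lower hX Lcard (no_gap_cofinal_cut hX nogap) SL FU Fdiv FS.
have hXd := GO_space_dual hX.
have nB := divergent_no_lower hXd Lcard
  (no_gap_cofinal_cut hXd (no_gap_dual nogap)) SL FU Fdiv FS.
have [side _] := divergent_open hX FU Fdiv.
have [//|nFA] := in_ultra_setVsetC [set p | F [set y | p < y]] FU.
by apply: nB; apply: (filterS _ nFA) => p /=; case: (side p).
Qed.

(** * The equivalence *)

Lemma open_accumulation_sub (X : topologicalType) (L : Type)
    (is_nu is_nu' : forall d, orderType d -> Prop)
    (P P' : forall d (N : orderType d), (N -> set X) -> Prop) :
  (forall d N, is_nu' d N -> is_nu d N) ->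
  (forall d N O, P' d N O -> P d N O) ->
  open_accumulation L is_nu P -> open_accumulation L is_nu' P'.
Proof.
by move=> nuS PS acc d N /nuS Nnu NL O Oo /PS; exact: acc.
Qed.

Theorem corollary5p1 (dL : Order.disp_t) (L : orderType dL)
    (hL : infinite_cardinal L) (dX : Order.disp_t) (X : POrderedTopological.type dX)
    (hX : GO_space X) :
  [<-> (exists2 D : set_system L, regular_ultrafilter D & D_compact X D);
       initially_compact X L;
       monotone_sequences_converge X L;
       no_gap_of_type_le X L;
       (exists2 D : set_system L, regular_ultrafilter D & D_pseudocompact X D);
       weakly_initially_compact X L;
       open_accumulation L (@infinite_cardinal) (@any_sets X);
       open_accumulation L (@infinite_cardinal) (@disjoint_sets X);
       open_accumulation L (@infinite_cardinal) (@decreasing_sets X);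
       open_accumulation L (@infinite_regular) (@any_sets X);
       open_accumulation L (@infinite_regular) (@disjoint_sets X);
       open_accumulation L (@infinite_regular) (@decreasing_sets X);
       (forall (I : Type) (D : set_system I),
          [set: I] #<= [set: L] -> UltraFilter D -> D_compact X D);
       (forall (I : Type) (D : set_system I),
          [set: I] #<= [set: L] -> UltraFilter D -> D_pseudocompact X D);
       lambda_bounded X L].
Proof.
have hXd := GO_space_dual hX.
have [Lcard Linf] := hL.
have [D Dreg] := exists_regular_ultrafilter Linf.
have regular_card d N : @infinite_regular d N -> @infinite_cardinal d N by case.
have gap_bdd : no_gap_of_type_le X L -> lambda_bounded X L by exact: no_gap_bounded.
have mono_gap : monotone_sequences_converge X L -> no_gap_of_type_le X L.
  move=> mono; apply: cofinal_cut_no_gap; apply: monotone_no_cofinal_cut => //.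
  by move=> d N Nreg NL x; have [? ?] := mono d N Nreg NL x; split.
have disj_gap : open_accumulation L (@infinite_regular) (@disjoint_sets X) ->
    no_gap_of_type_le X L.
  by move=> acc; apply: cofinal_cut_no_gap; apply: disjoint_no_cofinal_cut.
have decr_gap : open_accumulation L (@infinite_regular) (@decreasing_sets X) ->
    no_gap_of_type_le X L.
  by move=> acc; apply: cofinal_cut_no_gap; apply: decreasing_no_cofinal_cut.
have bdd_comp : lambda_bounded X L -> forall (I : Type) (D : set_system I),
    [set: I] #<= [set: L] -> UltraFilter D -> D_compact X D.
  by move=> Xb I E; exact: lambda_bounded_D_compact.
have bdd_mono : lambda_bounded X L -> monotone_sequences_converge X L.
  move=> Xb d N Nreg NL x; split=> xmon.
    exact: (bounded_increasing_converge hX Xb Nreg NL xmon).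
  exact: (@bounded_increasing_converge _ X^d L hXd _ N x Xb Nreg NL xmon).
have comp_pseudo : (forall (I : Type) (D : set_system I),
      [set: I] #<= [set: L] -> UltraFilter D -> D_compact X D) ->
    forall (I : Type) (D : set_system I),
      [set: I] #<= [set: L] -> UltraFilter D -> D_pseudocompact X D.
  by move=> Xc I E IL EU; apply: D_compact_pseudocompact; exact: Xc.
have weak_reg := @weakly_initially_compact_accumulation X L.
tfae.
- by move=> [E Ereg Ec]; exact: D_compact_initially_compact Ec.
- move=> /initially_compact_weakly/(weak_reg (@decreasing_sets X))/decr_gap/gap_bdd.
  exact: bdd_mono.
- exact: mono_gap.
- move=> /gap_bdd/bdd_comp/comp_pseudo Xp; exists D => //.
  by apply: Xp (card_lexx _) _; case: Dreg.
- by move=> [E Ereg Ep]; exact: D_pseudocompact_weakly_initially_compact Ep.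
- move=> /(weak_reg (@decreasing_sets X))/decr_gap/gap_bdd/bdd_comp/comp_pseudo.
  exact: D_pseudocompact_accumulation.
- exact: open_accumulation_sub.
- move=> /(open_accumulation_sub regular_card (fun _ _ _ => id))/disj_gap/gap_bdd.
  by move=> /bdd_comp/comp_pseudo; exact: D_pseudocompact_accumulation.
- move=> /(open_accumulation_sub regular_card (fun _ _ _ => id))/decr_gap/gap_bdd.
  move=> /bdd_comp/comp_pseudo Xp.
  by apply: (open_accumulation_sub regular_card (fun _ _ _ => id));
    exact: D_pseudocompact_accumulation.
- exact: open_accumulation_sub.
- move=> /disj_gap/gap_bdd/bdd_comp/comp_pseudo Xp.
  by apply: (open_accumulation_sub regular_card (fun _ _ _ => id));
    exact: D_pseudocompact_accumulation.
- by move=> /decr_gap/gap_bdd/bdd_comp.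
- exact: comp_pseudo.
- move=> Xp; apply: gap_bdd; apply: decr_gap.
  by apply: (open_accumulation_sub regular_card (fun _ _ _ => id));
    exact: D_pseudocompact_accumulation.
- by move=> /bdd_comp Xc; exists D => //; apply: Xc (card_lexx _) _; case: Dreg.
Qed.
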